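(* Let $r$ and $s$ be positive integers such that $r \geq 2$ and $s$ is even. Let $W$ be a set of exactly $s/2$ positive integers. There exists an infinite set $A$ of positive integers such that $A$ generates the additive group $\mathbf{Z}$ and $S_A(r) = W \cup (-W)$. In particular, the pair $(\mathbf{Z}, A)$ has phase transition $(r,s)$.
   Context: A subset $A$ of an additive abelian group $G$ is a generating set for $G$ if every element of $G$ is a finite sum of elements of $A \cup (-A)$, where $-A = \{-a : a \in A\}$ and the empty sum is $0$. For $x \in G$, the word length $\ell_A(x)$ is the smallest integer $k \ge 0$ such that $x$ is a sum of $k$ elements of $A \cup (-A)$ (repetitions allowed). For every nonnegative integer $k$, $S_A(k) = \{x \in G : \ell_A(x) = k\}$ and $L_A(k) = |S_A(k)| \in \{0,1,2,\ldots\} \cup \{\infty\}$. If $A$ is an infinite generating set for $G$ such that $L_A(r') = 0$ for some integer $r'\ge 0$, let $r$ be the largest integer such that $L_A(r) > 0$ and let $s = L_A(r) = |S_A(r)|$; the ordered pair $(r,s)$ is called the phase transition of $A$ (or of the pair $(G,A)$), and $S_A(r)$ is called the transition set. *)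

(* Defs.v *)
From mathcomp Require Import all_boot all_order all_algebra.
From mathcomp Require Import finmap.
From mathcomp Require Import boolp classical_sets functions cardinality.

Set Implicit Arguments.
Unset Strict Implicit.
Unset Printing Implicit Defensive.

Import Order.TTheory GRing.Theory Num.Theory.

Local Open Scope classical_set_scope.
Local Open Scope ring_scope.

Definition opp_set (G : zmodType) (A : set G) : set G := [set - a | a in A].

(* Cardinality in {0, 1, 2, ...} together with infinity; None is infinity. *)
Definition card_inf (T : choiceType) (X : set T) : option nat :=
  if `[< finite_set X >] then Some #|` fset_set X|%N else None.

Definition is_sum_of (G : zmodType) (A : set G) (k : nat) (x : G) : Prop :=
  exists a : k.-tuple G,
    (forall i : 'I_k, (A `|` opp_set A) (tnth a i)) /\
    x = \sum_(i < k) tnth a i.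

Definition generating (G : zmodType) (A : set G) : Prop :=
  forall x : G, exists k : nat, is_sum_of A k x.

(* The word length is a relation because it is undefined for elements outside
   the subgroup generated by A. *)
Definition has_word_length (G : zmodType) (A : set G) (x : G) (k : nat) : Prop :=
  is_sum_of A k x /\ (forall j : nat, is_sum_of A j x -> (k <= j)%N).

Definition word_sphere (G : zmodType) (A : set G) (k : nat) : set G :=
  [set x | has_word_length A x k].

Definition sphere_card (G : zmodType) (A : set G) (k : nat) : option nat :=
  card_inf (word_sphere A k).

Definition phase_transition (G : zmodType) (A : set G)
    (r : nat) (s : option nat) : Prop :=
  [/\ infinite_set A /\ generating A,
      exists r' : nat, sphere_card A r' = Some 0%N,
      sphere_card A r <> Some 0%N,
      forall k : nat, sphere_card A k <> Some 0%N -> (k <= r)%N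
    & s = sphere_card A r].

(* Main.v *)
(* Write r = h + 2. For every integer n > 0 outside W, put into A the numbers
   b_(n,i) = M_n (h + 2)^i for i < h and c_n = n + \sum_i b_(n,i), where M_n
   grows fast. Then n = c_n - \sum_i b_(n,i) is a sum of h + 1 terms. Conversely
   a sum of at most h + 1 terms whose value is small compared with M_0 must be 0
   or +-n for one of these n: if N is the largest index that occurs, the value is
   M_N X + N y + (lower terms), so X = 0, and comparing digits in base h + 2 the
   net coefficient of every b_(N,i) is -y, where y is that of c_N. If y = 0 the
   index N cancels out; otherwise all h + 1 terms have index N and y = +-1.
   Finally w in W has length exactly h + 2, because w - a is outside +-W and
   nonzero for large a in A. *)
Require Import Defs.
From mathcomp Require Import all_boot all_order all_algebra.
From mathcomp Require Import finmap.
From mathcomp Require Import boolp classical_sets functions cardinality.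
From mathcomp Require Import zify ring.

Set Implicit Arguments.
Unset Strict Implicit.
Unset Printing Implicit Defensive.

Import Order.TTheory GRing.Theory Num.Theory.

Local Open Scope classical_set_scope.
Local Open Scope ring_scope.

(** * Uniqueness of signed digits *)

(** Modulo [g] only [e 0] survives, and a multiple of [g] smaller than [g] in absolute value is 0;
    divide by [g] and repeat. *)
Lemma digits_eq0 (g : int) (m : nat) (e : nat -> int) :
  (forall i, (i < m)%N -> `|e i| < g) ->
  \sum_(i < m) e i * g ^+ i = 0 -> forall i, (i < m)%N -> e i = 0.
Proof.
elim: m e => [//|m IHm] e lt_eg.
rewrite big_ord_recl expr0 mulr1 /= => sum0.
have e0g := lt_eg 0%N isT.
have sumE : \sum_(i < m) e (bump 0 i) * g ^+ bump 0 i
    = g * \sum_(i < m) e i.+1 * g ^+ i.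
  rewrite mulr_sumr; apply: eq_bigr => i _.
  by rewrite /bump /= add1n exprS; ring.
rewrite sumE in sum0.
set S := (X in _ + _ * X = 0) in sum0.
have S0 : S = 0 by nia.
have e0 : e 0%N = 0 by move: sum0; rewrite S0 mulr0 addr0.
move=> [//|i] lt_im.
by apply: (IHm (fun i => e i.+1)) => // k lt_km; apply: lt_eg.
Qed.

(** * The elements of A and the growth of M *)

(* [elt h M n i] is b_(n,i) for [i < h], and [elt h M n h] is c_n; [digit h j i]
   is the coefficient of [M n * (h + 2) ^ i] in [elt h M n j]. *)
Definition digit (h j i : nat) : int := (j == i)%:R + (j == h)%:R.

Definition elt (h : nat) (M : nat -> nat) (n j : nat) : int :=
  (j == h)%:R * n%:Z + (M n)%:Z * \sum_(i < h) digit h j i * h.+2%:Z ^+ i.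

(* [t = (b, n, j)] encodes the summand (-1)^b * elt n j. *)
Definition sgn_elt (h : nat) (M : nat -> nat) (t : bool * nat * nat) : int :=
  (-1) ^+ t.1.1 * elt h M t.1.2 t.2.

(** The factor [h.+1] lets [M N] exceed [V], a multiple of [N] by at most h + 1, and up to h + 1
    elements of lower index, all together. The first clause covers the case of no lower elements. *)
Definition sparse (h V : nat) (M : nat -> nat) : Prop := forall N,
  (V + h.+1 * N < M N)%N /\
  forall n j, (n < N)%N -> (j <= h)%N ->
    V%:Z + h.+1%:Z * (N%:Z + elt h M n j) < (M N)%:Z.

Lemma digit_ge0 h j i : 0 <= digit h j i.
Proof. by rewrite /digit addr_ge0 ?ler0n. Qed.

Lemma digit_le1 h j i : (i < h)%N -> digit h j i <= 1.
Proof. by move=> lt_ih; rewrite /digit; lia. Qed.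

Lemma elt_ge0 h M n j : 0 <= elt h M n j.
Proof.
rewrite /elt addr_ge0 // mulr_ge0 // sumr_ge0 // => i _.
by rewrite mulr_ge0 ?digit_ge0 // exprn_ge0.
Qed.

Lemma elt_le h M n j :
  elt h M n j <= n%:Z + (M n)%:Z * \sum_(i < h) h.+2%:Z ^+ i.
Proof.
rewrite /elt lerD //; first by case: (j == h); rewrite ?mul1r ?mul0r.
rewrite ler_wpM2l // ler_sum // => i _.
by rewrite ler_piMl ?exprn_ge0 // digit_le1.
Qed.

Lemma exists_sparse h V : exists M, sparse h V M.
Proof.
pose C := (\sum_(i < h) h.+2 ^ i)%N.
(* [m + C * M m] bounds the elements of index [m]; [M m] carries the earlier inequalities over, and
   the lone [h.+1] pays for raising [N] by 1. *)
pose M := fix M n := if n is m.+1 then (M m + h.+1 + h.+1 * (m + C * M m))%N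
  else V.+1.
have CE : C%:Z = \sum_(i < h) h.+2%:Z ^+ i.
  rewrite /C -[LHS]natz natr_sum; apply: eq_bigr => i _.
  by rewrite natrX natz.
exists M; elim=> [|N [IH1 IH2]]; first by split=> //; rewrite muln0 addn0.
split=> [|n j]; first by rewrite /=; nia.
rewrite ltnS leq_eqVlt => /orP[/eqP->|lt_nN] le_jh.
  have := ler_wpM2l (isT : 0 <= h.+1%:Z) (elt_le h M N j).
  by rewrite -CE /=; nia.
have := IH2 n j lt_nN le_jh; rewrite /=; nia.
Qed.

(** * Short signed sums of small value *)

Lemma normr_sum_le (I : eqType) (s : seq I) (F : I -> int) (m : nat) (K : int) :
  (0 < m)%N -> (size s <= m)%N -> 0 <= K ->
  (forall i, i \in s -> m%:Z * `|F i| <= K) -> `|\sum_(i <- s) F i| <= K.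
Proof.
move=> m_gt0 size_s K_ge0 leFK.
have : m%:Z * `|\sum_(i <- s) F i| <= (size s)%:Z * K.
  elim: s {size_s} leFK => [|i s IHs] leFK; first by rewrite big_nil normr0 mulr0 mul0r.
  rewrite big_cons /= (le_trans (ler_wpM2l _ (ler_normD _ _))) // mulrDr.
  rewrite -add1n PoszD mulrDl mul1r lerD ?leFK ?mem_head // IHs // => k ks.
  by rewrite leFK // in_cons ks orbT.
move=> /le_trans le_sK; rewrite -(ler_pM2l (_ : 0 < m%:Z)) // le_sK //.
by rewrite ler_wpM2r.
Qed.

(** [x j] is the net coefficient of the element [j]. As c_N contains every b_(N,i), digit [i]
    collects [x i + x h]. *)
Lemma sgn_elt_sumE h M N (s : seq (bool * nat * nat)) :
  let x j : int := \sum_(t <- s) (-1) ^+ t.1.1 * (t.2 == j)%:R in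
  (forall t, t \in s -> t.1.2 = N) ->
  \sum_(t <- s) sgn_elt h M t =
  (M N)%:Z * (\sum_(i < h) (x i + x h) * h.+2%:Z ^+ i) + N%:Z * x h.
Proof.
move=> x sN.
have -> : \sum_(i < h) (x i + x h) * h.+2%:Z ^+ i
    = \sum_(t <- s) (-1) ^+ t.1.1 * \sum_(i < h) digit h t.2 i * h.+2%:Z ^+ i.
  under [RHS]eq_bigr do rewrite mulr_sumr.
  rewrite exchange_big; apply: eq_bigr => i _ /=.
  rewrite /x -big_split /= mulr_suml; apply: eq_bigr => t _.
  by rewrite /digit; ring.
rewrite /x !mulr_sumr -big_split; apply: eq_big_seq => t /sN tN /=.
by rewrite /sgn_elt /elt tN; ring.
Qed.

(** Each term of [s] contributes to at most one of the net coefficients. *)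
Lemma sum_count_le (h : nat) (s : seq (bool * nat * nat)) :
  \sum_(j < h) `|\sum_(t <- s) (-1) ^+ t.1.1 * (t.2 == j)%:R| <= (size s)%:Z.
Proof.
elim: s => [|t s IHs].
  by rewrite big1 // => j _; rewrite big_nil normr0.
have le1 : \sum_(j < h) (t.2 == j)%:R <= 1 :> int.
  case: (ltnP t.2 h) => [lt_th|le_ht].
    rewrite (bigD1 (Ordinal lt_th)) //= eqxx big1 ?addr0 // => j.
    by rewrite -val_eqE eq_sym /= => /negPf->.
  rewrite big1 // => j _; case: eqP => // tj.
  by have := ltn_ord j; rewrite -tj ltnNge le_ht.
apply: le_trans (_ : \sum_(j < h) ((t.2 == j)%:R + 
    `|\sum_(t <- s) (-1) ^+ t.1.1 * (t.2 == j)%:R|) <= _).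
  apply: ler_sum => j _; rewrite big_cons (le_trans (ler_normD _ _)) // lerD2r.
  by rewrite normrM normrX normrN1 expr1n mul1r normr_nat.
by rewrite big_split /= -[(size s).+1]add1n PoszD lerD.
Qed.

(** Induction on a strict bound for the indices: [s1] takes the terms of the largest allowed index,
    [s2] the others. *)
Lemma small_sgn_elt_sum h V M N (s : seq (bool * nat * nat)) :
  sparse h V M ->
  (forall t, t \in s -> (t.1.2 < N)%N /\ (t.2 <= h)%N) ->
  (size s <= h.+1)%N ->
  let v := \sum_(t <- s) sgn_elt h M t in
  `|v| <= V%:Z -> v = 0 \/ exists2 t, t \in s & `|v| = t.1.2.
Proof.
move=> Msparse.
elim: N s => [|N IHN] s s_lt size_s v le_vV.
  left; rewrite /v; case: s s_lt {size_s v le_vV} => [|t s] s_lt.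
    by rewrite big_nil.
  by have [] := s_lt t (mem_head _ _).
pose top (t : bool * nat * nat) := t.1.2 == N.
set s1 := filter top s; set s2 := filter (predC top) s.
have size12 : (size s1 + size s2 = size s)%N by rewrite !size_filter count_predC.
have size_s2 : (size s2 <= h.+1)%N.
  by rewrite (leq_trans _ size_s) // -size12 leq_addl.
have vE : v = \sum_(t <- s1) sgn_elt h M t + \sum_(t <- s2) sgn_elt h M t.
  by rewrite !big_filter /v (bigID top).
have s1N t : t \in s1 -> t.1.2 = N by rewrite mem_filter => /andP[/eqP].
have s2N t : t \in s2 -> (t.1.2 < N)%N /\ (t.2 <= h)%N.
  rewrite mem_filter /top /= => /andP[neN /s_lt[ltN ->]]; split=> //.
  by rewrite ltn_neqAle neN -ltnS.
pose x j : int := \sum_(t <- s1) (-1) ^+ t.1.1 * (t.2 == j)%:R.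
have s1E := sgn_elt_sumE h M s1N; rewrite -/x in s1E.
set X := \sum_(i < h) _ in s1E.
have sum_x : \sum_(j < h) `|x j| + `|x h| <= (size s1)%:Z.
  by have := sum_count_le h.+1 s1; rewrite big_ord_recr.
have xi_le i : (i < h)%N -> `|x i| <= \sum_(j < h) `|x j|.
  move=> lt_ih; rewrite (bigD1 (Ordinal lt_ih)) //= lerDl.
  by apply: sumr_ge0 => ? _.
have sum_x_ge0 : 0 <= \sum_(j < h) `|x j| by apply: sumr_ge0 => ? _.
have [MN1 MN2] := Msparse N.
have X0 : X = 0.
  have : `|\sum_(t <- s2) sgn_elt h M t| + V%:Z + h.+1%:Z * N%:Z < (M N)%:Z.
    (* [K] is the room that [M N] leaves for the lower terms; it is nonnegative even if [s2] is
       empty. *)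
    have : 0 <= (M N)%:Z - V%:Z - h.+1%:Z * N%:Z - 1 by lia.
    set K := _ - 1 => K_ge0.
    have : `|\sum_(t <- s2) sgn_elt h M t| <= K; last by rewrite /K; lia.
    apply: (@normr_sum_le _ _ _ h.+1) => //.
    move=> t /s2N[lt_tN le_th]; have := MN2 _ _ lt_tN le_th.
    rewrite /sgn_elt normrM normrX normrN1 expr1n mul1r ger0_norm ?elt_ge0 //.
    by rewrite /K mulrDr; move: (h.+1%:Z * elt _ _ _ _) => e; lia.
  have xh_le : `|N%:Z * x h| <= h.+1%:Z * N%:Z.
    by rewrite normrM mulrC ler_wpM2r //; lia.
  have MXE : (M N)%:Z * X = v - \sum_(t <- s2) sgn_elt h M t - N%:Z * x h.
    by rewrite vE s1E; ring.
  move: MXE le_vV xh_le; move: (\sum_(t <- s2) _) (N%:Z * x h) (h.+1%:Z * _).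
  move=> S Nx hN MXE le_vV xh_le lt_SM.
  have : `|(M N)%:Z * X| < (M N)%:Z by rewrite MXE; lia.
  by rewrite normrM; nia.
have e0 := @digits_eq0 _ h (fun i => x i + x h) _ X0.
(* The digits [x k + x h] are at most [size s1 <= h.+1] in absolute value, hence below the base
   [h.+2]. *)
have {}e0 i : (i < h)%N -> x i = - x h.
  move=> lt_ih; apply/eqP; rewrite -addr_eq0; apply/eqP/e0 => // k lt_kh.
  have := xi_le k lt_kh; lia.
(* All h + 1 net coefficients now have the same absolute value, so a nonzero [x h] uses up every
   available term. *)
have sum_xE : h.+1%:Z * `|x h| <= (size s1)%:Z.
  apply: le_trans sum_x.
  rewrite (eq_bigr (fun=> `|x h|)) => [|i _]; last by rewrite e0 // normrN.
  by rewrite sumr_const card_ord -mulr_natl natz; lia.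
rewrite X0 mulr0 add0r -/(x h) in s1E.
have [xh0|xhN0] := eqVneq (x h) 0.
  have vE2 : v = \sum_(t <- s2) sgn_elt h M t.
    by rewrite vE s1E xh0 mulr0 add0r.
  have := IHN s2 s2N size_s2; rewrite /= -vE2 => /(_ le_vV)[->|[t ts2 tv]].
    by left.
  by right; exists t => //; move: ts2; rewrite mem_filter => /andP[].
have xh1 : `|x h| = 1 by nia.
have s1h : size s1 = h.+1 by lia.
have s20 : s2 = [::] by apply: size0nil; lia.
right; have : N%:Z = `|v| by rewrite vE s1E s20 big_nil addr0 normrM xh1 mulr1.
case s1_cons: s1 s1h => [//|t s1'] _ NE.
have ts1 : t \in s1 by rewrite s1_cons mem_head.
exists t; last by rewrite (s1N t ts1).
by move: ts1; rewrite mem_filter => /andP[].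
Qed.

(** * Sums of elements of A *)

Definition gen_set (h : nat) (M : nat -> nat) (P : set nat) : set int :=
  [set x | exists n j, [/\ P n, (j <= h)%N & x = elt h M n j]].

Lemma is_sum_ofN (G : zmodType) (A : set G) k x :
  is_sum_of A k x -> is_sum_of A k (- x).
Proof.
move=> [a [aA ->]]; exists [tuple - tnth a i | i < k]; split=> [i|].
  rewrite tnth_mktuple; case: (aA i) => [aiA|[y yA <-]]; last by left; rewrite opprK.
  by right; exists (tnth a i).
by rewrite -sumrN; apply: eq_bigr => i _; rewrite tnth_mktuple.
Qed.

Lemma is_sum_ofS (G : zmodType) (A : set G) k a x :
  A a -> is_sum_of A k x -> is_sum_of A k.+1 (a + x).
Proof.
move=> aA [b [bA ->]]; exists (cons_tuple a b); split=> [i|].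
  by case: (unliftP ord0 i) => [j|] ->; rewrite ?tnthS ?tnth0 //; left.
by rewrite big_ord_recl tnth0; congr (_ + _); apply: eq_bigr => i _; rewrite tnthS.
Qed.

(** Lists replace tuples so that a sum can be split by index. *)
Lemma is_sum_of_sgn_elt h M P k x : is_sum_of (gen_set h M P) k x ->
  exists2 s : seq (bool * nat * nat),
    size s = k /\ (forall t, t \in s -> P t.1.2 /\ (t.2 <= h)%N)
    & x = \sum_(t <- s) sgn_elt h M t.
Proof.
move=> [a [aA xE]].
have [l [lA size_l ->]] : exists l : seq int, [/\ forall y, y \in l ->
    (gen_set h M P `|` opp_set (gen_set h M P)) y, size l = k & x = \sum_(y <- l) y].
  by exists (tval a); rewrite size_tuple big_tuple; split=> // y /tnthP[i ->].
rewrite -size_l; elim: l lA {size_l} => [|y l IHl] lA; first by exists [::]; rewrite ?big_nil.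
have [z zl|s [size_s sP] sE] := IHl; first by apply: lA; rewrite in_cons zl orbT.
have [b [n [j [Pn le_jh yE]]]] : exists b n j,
    [/\ P n, (j <= h)%N & y = (-1) ^+ (b : bool) * elt h M n j].
  have [[n [j [Pn le_jh ->]]]|[_ [n [j [Pn le_jh ->]]] <-]] := lA y (mem_head _ _).
    by exists false, n, j; rewrite mul1r.
  by exists true, n, j; rewrite mulN1r.
exists ((b, n, j) :: s); last by rewrite !big_cons sE yE.
by split=> [|t]; rewrite /= ?size_s // in_cons => /orP[/eqP->|/sP].
Qed.

Lemma gen_set_avoid h V M P k x : sparse h V M -> (k <= h.+1)%N ->
  is_sum_of (gen_set h M P) k x -> `|x| <= V%:Z ->
  x = 0 \/ exists2 n : nat, P n & `|x| = n.
Proof.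
move=> Msparse le_kh /is_sum_of_sgn_elt[s [size_s sP] ->] le_V.
rewrite -size_s in le_kh.
pose N := (\sum_(t <- s) t.1.2).+1.
have s_lt t : t \in s -> (t.1.2 < N)%N /\ (t.2 <= h)%N.
  move=> ts; split; last by have [] := sP t ts.
  by rewrite ltnS (big_rem t) //= leq_addr.
have [|[t /sP[Pt _] tE]] := small_sgn_elt_sum Msparse s_lt le_kh le_V; first by left.
by right; exists t.1.2.
Qed.

Lemma elt_lt h M n i : (i < h)%N -> elt h M n i = (M n)%:Z * h.+2%:Z ^+ i.
Proof.
move=> lt_ih; rewrite /elt (ltn_eqF lt_ih) mul0r add0r; congr (_ * _).
rewrite (bigD1 (Ordinal lt_ih)) //= /digit eqxx (ltn_eqF lt_ih) addr0 mul1r.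
rewrite big1 ?addr0 // => j; rewrite -val_eqE eq_sym /= => /negPf->.
by rewrite add0r mul0r.
Qed.

Lemma elt_top h M n :
  elt h M n h = n%:Z + \sum_(i < h) (M n)%:Z * h.+2%:Z ^+ i.
Proof.
rewrite /elt eqxx mul1r mulr_sumr; congr (_ + _); apply: eq_bigr => i _.
by rewrite /digit eqxx (gtn_eqF (ltn_ord i)) add0r mul1r.
Qed.

Lemma gen_set_sum h M (P : set nat) n :
  P n -> is_sum_of (gen_set h M P) h.+1 n%:Z.
Proof.
move=> Pn; pose a (i : nat) := if i == h then elt h M n i else - elt h M n i.
exists [tuple a i | i < h.+1]; split=> [i|].
  rewrite tnth_mktuple /a; case: eqP => _; [left|right; exists (elt h M n i) => //];
    by exists n, i; split=> //; rewrite -ltnS.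
under eq_bigr do rewrite tnth_mktuple.
rewrite big_ord_recr /= /a eqxx elt_top.
rewrite (eq_bigr (fun i : 'I_h => - ((M n)%:Z * h.+2%:Z ^+ i))) => [|i _].
  by rewrite sumrN addrCA addNr addr0.
by rewrite (ltn_eqF (ltn_ord i)) elt_lt.
Qed.

(** * Finite sets of integers *)

Lemma finite_set_int_bounded (X : set int) :
  finite_set X -> exists B : nat, forall x, X x -> `|x| <= B%:Z.
Proof.
move=> /finite_seqP[s ->]; exists (\sum_(x <- s) `|x|%N)%N => x /= xs.
by rewrite (big_rem x) //=; lia.
Qed.

Lemma card_inf0 (T : choiceType) : card_inf (set0 : set T) = Some 0%N.
Proof. by rewrite /card_inf asboolT ?finite_set0 // fset_set0 cardfs0. Qed.

(** Positivity makes [W] and its opposite disjoint. *)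
Lemma card_inf_symm (W : set int) m : (forall w, W w -> 0 < w) ->
  card_inf W = Some m -> card_inf (W `|` opp_set W) = Some m.*2.
Proof.
rewrite /card_inf => W_gt0; case: asboolP => // Wfin [Wm].
have NWfin : finite_set (opp_set W) by apply: finite_image.
rewrite asboolT ?finite_setU // fset_setU // cardfsU.
have -> : (fset_set W `&` fset_set (opp_set W) = fset0)%fset.
  apply/fsetP => x; rewrite inE !in_fset_set // in_fset0.
  apply/negP => /andP[/set_mem /W_gt0 x_gt0 /set_mem[w /W_gt0 w_gt0 wx]].
  by move: x_gt0; rewrite -wx oppr_gt0 => /lt_trans/(_ w_gt0); rewrite ltxx.
rewrite cardfs0 subn0 /opp_set fset_set_image // card_imfset /= ?Wm ?addnn //.
Qed.

(** * Word lengths with respect to A *)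

Theorem theorem4 (r s : nat) (hr : (2 <= r)%N) (hs : (0 < s)%N)
  (s_even : ~~ odd s) (W : set int) (W_pos : forall w : int, W w -> 0 < w)
  (W_card : card_inf W = Some s./2) :
  exists A : set int,
    [/\ infinite_set A,
        forall a : int, A a -> 0 < a,
        generating A,
        word_sphere A r = W `|` opp_set W
      & phase_transition A r (Some s)].
Proof.
have W_fin : finite_set W by move: W_card; rewrite /card_inf; case: asboolP.
have [V W_le] := finite_set_int_bounded W_fin.
have [h ->] : exists h, r = h.+2 by exists r.-2; lia.
have [M Msparse] := exists_sparse h V.
(* For [h = 0] the element c_n is [n] itself, so [0 < n] is what keeps A positive. *)
pose P : set nat := [set n | (0 < n)%N /\ ~ W n%:Z].
pose A := gen_set h M P; pose U := W `|` opp_set W.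
have M_gt0 n : (0 < M n)%N by have [+ _] := Msparse n; lia.
have A_gt0 a : A a -> 0 < a.
  move=> [n [j [[n_gt0 _] le_jh ->]]]; move: le_jh; rewrite leq_eqVlt.
  case/orP => [/eqP->|lt_jh].
    by rewrite elt_top ltr_wpDr // sumr_ge0 // => i _; rewrite mulr_ge0 ?exprn_ge0.
  by rewrite elt_lt // mulr_gt0 ?exprn_gt0 //; exact: M_gt0.
have A_unbounded (B : nat) : exists2 a, A a & B%:Z < a.
  (* Being above [V] keeps [n] out of [W]; being above [B] suffices since c_n is at least [n]. *)
  pose n := (B + V).+1; exists (elt h M n h).
    exists n, h; split=> //; split=> // /W_le; lia.
  have : 0 <= \sum_(i < h) (M n)%:Z * h.+2%:Z ^+ i.
    by apply: sumr_ge0 => i _; rewrite mulr_ge0 ?exprn_ge0.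
  by rewrite elt_top; lia.
have A_inf : infinite_set A.
  move=> /finite_set_int_bounded[B A_le]; have [a /A_le] := A_unbounded B; lia.
have absU x : U x <-> W `|x|.
  split=> [[Wx|[w Ww <-]]|]; rewrite ?normrN.
  - by rewrite gtr0_norm ?W_pos.
  - by rewrite gtr0_norm ?W_pos.
  - have [x_ge0|x_lt0] := lerP 0 x.
      by rewrite ger0_norm // => Wx; left.
    by rewrite ltr0_norm // => Wx; right; exists (- x); rewrite ?opprK.
have sumNU x : ~ U x -> x = 0 \/ is_sum_of A h.+1 x.
  move=> /absU NWx; have [->|x_neq0] := eqVneq x 0; first by left.
  right; have : is_sum_of A h.+1 `|x|%N%:Z.
    by apply: gen_set_sum; split; rewrite ?absz_gt0 // abszE.
  rewrite abszE; have [x_ge0|x_lt0] := lerP 0 x; first by rewrite ger0_norm.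
  by rewrite ltr0_norm // => /is_sum_ofN; rewrite opprK.
have sum0 : is_sum_of A 0 0.
  by exists [tuple]; split=> [[]|] //; rewrite big_ord0.
have sumU x k : U x -> (k <= h.+1)%N -> ~ is_sum_of A k x.
  move=> /absU Wx le_kh Ax.
  have [|x0|[n [_ NWn] xn]] := gen_set_avoid Msparse le_kh Ax.
  - by have := W_le _ Wx; rewrite normr_id.
  - by have := W_pos _ Wx; rewrite x0 normr0 ltxx.
  - by apply: NWn; rewrite -xn.
have sumU2 x : U x -> is_sum_of A h.+2 x.
  move=> /absU/W_le; rewrite normr_id => x_le.
  (* Since [x] is at most [V] in absolute value, [x - a] lies below [- V]: it is nonzero and outside
     [U], so it is a sum of h + 1 terms. *)
  have [a Aa lt_a] := A_unbounded (V + V)%N.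
  rewrite -(subrKC a x); apply: is_sum_ofS => //.
  have NU : ~ U (x - a) by move=> /absU/W_le; rewrite normr_id; lia.
  by have [xa0|//] := sumNU _ NU; lia.
have sphereE : word_sphere A h.+2 = U.
  apply/seteqP; split=> x.
    move=> [_ min_x]; apply: contrapT => /sumNU[x0|/min_x]; last by lia.
    by move: sum0; rewrite -x0 => /min_x.
  move=> Ux; split=> [|k Ak]; first exact: sumU2.
  by rewrite ltnNge; apply/negP => /(sumU x k Ux)/(_ Ak).
(* Every integer has length at most h + 2: [sumU2] bounds it on [U], and [sumNU] with [sum0] off
   [U]. *)
have sphere0 k : (h.+2 < k)%N -> word_sphere A k = set0.
  move=> lt_hk; apply/seteqP; split=> x // [_ min_x].
  have [/sumU2/min_x|/sumNU[x0|/min_x]] := pselect (U x); try lia.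
  by move: sum0; rewrite -x0 => /min_x; lia.
have gen : generating A.
  move=> x; have [/sumU2 ?|/sumNU[->|?]] := pselect (U x); first by exists h.+2.
    by exists 0%N.
  by exists h.+1.
have cardU : sphere_card A h.+2 = Some s.
  by rewrite /sphere_card sphereE (card_inf_symm W_pos W_card) even_halfK.
exists A; split=> //; split=> //.
- by exists h.+3; rewrite /sphere_card sphere0 // card_inf0.
- by rewrite cardU => -[s0]; rewrite s0 in hs.
- move=> k; apply: contra_notT; rewrite -ltnNge => lt_hk.
  by rewrite /sphere_card sphere0 // card_inf0.
Qed.
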